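(* Let $m$ be a positive integer with $m\not\equiv 1 \pmod 3$ and $m\not\equiv 1\pmod 8$, and let $G$ be an Abelian group. Then the ring $\mathrm{E}(G)$ is strongly $m$-nil clean if and only if $G\cong \bigoplus_{i=1}^n\bigoplus_{j=1}^{t_i}\mathbb{Z}_{p_i^{k_{i,j}}}$, where $p_1,p_2,\ldots,p_n$ are the prime factors of $|G|$ and $(p_i-1)\mid (m-1)$ for any $1\le i\le n$.
   Context: $\mathrm{E}(G)$ denotes the endomorphism ring of the Abelian group $G$. $\mathbb{Z}_q$ is the cyclic group of order $q$, and the exponents $k_{i,j}$ are positive integers. An element $x$ of a ring is $m$-potent if $x^m=x$. A ring is strongly $m$-nil clean if each of its elements is a sum of an $m$-potent element and a nilpotent element that commute with each other.
   Formalization: For each prime p_i the exponents k_{i,1},…,k_{i,t_i} are required to be pairwise distinct; with repeated exponents the claim fails, e.g. m = 2 and G = Z_2 ⊕ Z_2, where E(G) = M_2(F_2) has an element a with a^2 − a = 1. *)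

(* Defs.v *)
From HB Require Import structures.
From mathcomp Require Import all_boot all_order all_algebra.
From mathcomp Require Import boolp classical_sets functions cardinality.

Set Implicit Arguments.
Unset Strict Implicit.
Unset Printing Implicit Defensive.

Import GRing.Theory.
Local Open Scope ring_scope.

(* [pzRingType] rather than [nzRingType]: the endomorphism ring of the trivial
   group is the zero ring. *)
Section StronglyNilClean.
Variable R : pzRingType.

Definition potent (m : nat) (x : R) : Prop := x ^+ m = x.

Definition nilpotent_elt (x : R) : Prop := exists k : nat, x ^+ k = 0.

Definition strongly_nil_clean (m : nat) : Prop :=
  forall x : R, exists e b : R,
    [/\ potent m e, nilpotent_elt b, GRing.comm e b & x = e + b].

End StronglyNilClean.

Arguments strongly_nil_clean R m : clear implicits.

(* The ring E(G): pointwise addition, multiplication is composition. *)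
Section EndomorphismRing.
Variable G : zmodType.

Definition endo : Type := {additive G -> G}.

HB.instance Definition _ := gen_eqMixin endo.
HB.instance Definition _ := gen_choiceMixin endo.

Lemma endoP (f g : endo) : f =1 g <-> f = g.
Proof.
split=> [|-> //]; case: f => f [[fP]]; case: g => g [[gP]] /= fg.
have {}fg : f = g by apply/funext.
case: g / fg gP => gP; congr (GRing.Additive.Pack (GRing.Additive.Class _)).
by congr (GRing.isNmodMorphism.Axioms_ _ _ _); apply: Prop_irrelevance.
Qed.

Definition endo_zero : endo := (\0 : G -> G) : {additive G -> G}.
Definition endo_opp (f : endo) : endo := (\- f : G -> G) : {additive G -> G}.
Definition endo_add (f g : endo) : endo :=
  (f \+ g : G -> G) : {additive G -> G}.
Definition endo_one : endo := (idfun : G -> G) : {additive G -> G}.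
Definition endo_mul (f g : endo) : endo :=
  (f \o g : G -> G) : {additive G -> G}.

Fact endo_addA : associative endo_add.
Proof. by move=> f g h; apply/endoP=> x /=; rewrite addrA. Qed.
Fact endo_addC : commutative endo_add.
Proof. by move=> f g; apply/endoP=> x /=; rewrite addrC. Qed.
Fact endo_add0 : left_id endo_zero endo_add.
Proof. by move=> f; apply/endoP=> x /=; rewrite add0r. Qed.
Fact endo_addN : left_inverse endo_zero endo_opp endo_add.
Proof. by move=> f; apply/endoP=> x /=; rewrite addNr. Qed.
HB.instance Definition _ :=
  GRing.isZmodule.Build endo endo_addA endo_addC endo_add0 endo_addN.

Fact endo_mulA : associative endo_mul.
Proof. by move=> f g h; apply/endoP. Qed.
Fact endo_mul1 : left_id endo_one endo_mul.
Proof. by move=> f; apply/endoP. Qed.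
Fact endo_mulr1 : right_id endo_one endo_mul.
Proof. by move=> f; apply/endoP. Qed.
Fact endo_mulDl : left_distributive endo_mul +%R.
Proof. by move=> f g h; apply/endoP. Qed.
Fact endo_mulDr : right_distributive endo_mul +%R.
Proof. by move=> f g h; apply/endoP=> x /=; rewrite raddfD. Qed.
HB.instance Definition _ := GRing.Zmodule_isPzRing.Build endo
  endo_mulA endo_mul1 endo_mulr1 endo_mulDl endo_mulDr.

Lemma endo0E x : (0 : endo) x = 0. Proof. by []. Qed.
Lemma endoNE (f : endo) x : (- f) x = - f x. Proof. by []. Qed.
Lemma endoDE (f g : endo) x : (f + g) x = f x + g x. Proof. by []. Qed.
Lemma endo1E x : (1 : endo) x = x. Proof. by []. Qed.
Lemma endoME (f g : endo) x : (f * g) x = f (g x). Proof. by []. Qed.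

End EndomorphismRing.

(* Over a finite index type the direct sum is the full product. *)
Section DirectSum.
Variables (I : finType) (A : I -> zmodType).

Definition dirsum : Type := {dffun forall i, A i}.

HB.instance Definition _ := Choice.on dirsum.

Definition dirsum_zero : dirsum := [ffun i => 0 : A i].
Definition dirsum_opp (x : dirsum) : dirsum := [ffun i => - x i : A i].
Definition dirsum_add (x y : dirsum) : dirsum := [ffun i => x i + y i : A i].

Fact dirsum_addA : associative dirsum_add.
Proof. by move=> x y z; apply/ffunP=> i; rewrite !ffunE addrA. Qed.
Fact dirsum_addC : commutative dirsum_add.
Proof. by move=> x y; apply/ffunP=> i; rewrite !ffunE addrC. Qed.
Fact dirsum_add0 : left_id dirsum_zero dirsum_add.
Proof. by move=> x; apply/ffunP=> i; rewrite !ffunE add0r. Qed.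
Fact dirsum_addN : left_inverse dirsum_zero dirsum_opp dirsum_add.
Proof. by move=> x; apply/ffunP=> i; rewrite !ffunE addNr. Qed.
HB.instance Definition _ := GRing.isZmodule.Build dirsum
  dirsum_addA dirsum_addC dirsum_add0 dirsum_addN.

Lemma dirsumDE (x y : dirsum) i : (x + y) i = x i + y i.
Proof. by rewrite ffunE. Qed.

End DirectSum.

Definition zmod_isog (G H : zmodType) : Prop :=
  exists f : {additive G -> H}, bijective f.

Definition has_order (G : zmodType) (N : nat) : Prop :=
  ([set: G] #= `I_N)%card.

(* ['Z_q] is the cyclic group of order [q] only for [1 < q], which holds for
   [q = p i ^ k i j] as soon as [p i] is prime and [0 < k i j].  When each
   [k i] is injective, no cyclic summand is repeated; repeating one puts a
   matrix ring over ['Z_q] inside the endomorphism ring, and for instance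
   E('Z_2 * 'Z_2) is not strongly 2-nil clean. *)
Definition primary_sum (n : nat) (p : 'I_n -> nat) (t : 'I_n -> nat)
    (k : forall i : 'I_n, 'I_(t i) -> nat) : zmodType :=
  dirsum (fun i : 'I_n => dirsum (fun j : 'I_(t i) => 'Z_(p i ^ k i j))).

(* Main.v *)
(* If x^m - x is nilpotent for every endomorphism x, then x = 2 bounds G and
   x = a shows p - 1 | m - 1 whenever G has p-torsion.  Consider the layers
   (p^k G \cap G[p]) / (p^(k+1) G \cap G[p]).  Two independent elements of a
   layer are p^k h1 and p^k h2 with h1, h2 independent modulo p^(k+1) G; as
   'Z_(p^(k+1)) is self-injective, any 2 x 2 matrix on h1, h2 extends to G.
   A matrix of order 3 (p = 2) or 8 (p odd) then contradicts the congruences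
   on m.  So every layer has dimension at most one, and lifting generators of
   the layers gives a basis of G by a purity argument.
   Conversely, if the layers are at most one-dimensional, every x acts on them
   by scalars, so x^p - x is nilpotent on the p-part and x^(p^c) for large c
   is the Teichmueller representative of x there; gluing these with the Chinese
   remainder idempotents gives the m-potent summand. *)
Require Import Defs.
From HB Require Import structures.
From mathcomp Require Import all_boot all_order all_algebra.
From mathcomp Require Import cyclic finfield.
From mathcomp Require Import boolp classical_sets functions cardinality.

Set Implicit Arguments.
Unset Strict Implicit.
Unset Printing Implicit Defensive.

Import GRing.Theory.
Local Open Scope ring_scope.

(** * Powers of commuting elements *)

(** The identity i C(q, i) = q C(q - 1, i - 1) with q = p^c shows that p^c divides i C(q, i), and i
    accounts only for its own p-part. *)
Lemma dvdn_bin_pfactor (p c i : nat) :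
  prime p -> (0 < i)%N -> (p ^ (c - logn p i) %| 'C(p ^ c, i))%N.
Proof.
move=> p_pr i0; have [le_iq|gt_iq] := leqP i (p ^ c); last by rewrite bin_small.
have C0 : (0 < 'C(p ^ c, i))%N by rewrite bin_gt0.
rewrite pfactor_dvdn // leq_subLR -lognM // -pfactor_dvdn ?muln_gt0 ?i0 //.
by case: i i0 {le_iq C0} => // i _; rewrite -mul_bin_diag dvdn_mulr.
Qed.

Lemma logn_lt (p i : nat) : (0 < i)%N -> (logn p i < i)%N.
Proof.
move=> i0; have [p_pr|/negPf np] := boolP (prime p); last first.
  by rewrite lognE np.
apply: leq_trans (ltn_expl _ (prime_gt1 p_pr)) _.
exact: dvdn_leq (pfactor_dvdnn _ _).
Qed.

Section PthPowers.
Variable R : pzRingType.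
Implicit Types x y a b : R.

(** The binomials C(p^c, i) with 0 < i < p^c are divisible by p, because [logn p i < c]. *)
Lemma exprD_pfactor (p c : nat) x y : prime p -> GRing.comm x y ->
  exists z, (x + y) ^+ (p ^ c) = x ^+ (p ^ c) + y ^+ (p ^ c) + z *+ p.
Proof.
move=> p_pr cxy; have dvd_bin := dvdn_bin_pfactor c p_pr.
have [q def_q] : exists q, (p ^ c)%N = q.+1.
  by exists (p ^ c).-1; rewrite prednK // expn_gt0 prime_gt0.
rewrite exprDn_comm // def_q; rewrite def_q in dvd_bin.
exists (\sum_(i < q) x ^+ (q - i) * y ^+ i.+1 *+ ('C(q.+1, i.+1) %/ p)).
rewrite big_ord_recl big_ord_recr /= bin0 /bump /= add1n subn0 subnn binn.
rewrite expr0 mulr1 mul1r -addrA [X in _ + X]addrC; congr (_ + (_ + _)).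
rewrite -sumrMnl; apply: eq_bigr => i _; rewrite -mulrnA divnK.
  by rewrite /bump /= add1n subSS.
have /= := dvd_bin i.+1 isT; apply: dvdn_trans.
rewrite -{1}[p]expn1 dvdn_exp2l // subn_gt0.
rewrite -(ltn_exp2l _ _ (prime_gt1 p_pr)) def_q.
by rewrite ltnS (leq_trans (dvdn_leq _ (pfactor_dvdnn _ _))).
Qed.

(* The binomials 'C(p ^ c, i) with small [i] > 0 are highly divisible by [p]. *)
Lemma expr_pfactor_stable (p K : nat) a b : prime p -> GRing.comm a b ->
  nilpotent_elt (a - b) -> (a - b) *+ (p ^ K) = 0 ->
  exists c0, forall c, (c0 <= c)%N -> a ^+ (p ^ c) = b ^+ (p ^ c).
Proof.
move=> p_pr cab [L nilL] pK; exists (K + L)%N => c lec.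
have -> : a = b + (a - b) by rewrite addrC subrK.
have cb : GRing.comm b (a - b) by apply: commrB; [apply/commr_sym | apply: commr_refl].
rewrite exprDn_comm // big_ord_recl /= bin0 subn0 expr0 mulr1 big1 ?addr0 //.
(* Terms with at least L factors a - b vanish by nilpotency; in the others p^K divides the binomial,
   since c >= K + L, and p^K kills a - b. *)
move=> i _; rewrite /bump /= add1n; have [leL|ltL] := leqP L i.+1.
  by rewrite -(subnK leL) exprD nilL !mulr0 mul0rn.
have /dvdnP[d ->] : (p ^ K %| 'C(p ^ c, i.+1))%N.
  apply: dvdn_trans (dvdn_bin_pfactor c p_pr (ltn0Sn i)).
  rewrite dvdn_exp2l // leq_subRL.
    rewrite addnC (leq_trans _ lec) // leq_add2l ltnW //.
    by rewrite (leq_trans (logn_lt _ _)) // ltnW.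
  rewrite (leq_trans _ lec) // (leq_trans _ (leq_addl _ _)) //.
  by rewrite ltnW // (leq_trans (logn_lt _ _)) // ltnW.
by rewrite mulnC mulrnA -mulrnAr exprSr -mulrnAr pK !mulr0 mul0rn.
Qed.

(** With x = e + b, the element b = x - e divides x^m - e^m = x^m - e, hence also x^m - x = (x^m -
    e) - b, and the cofactor commutes with b. *)
Lemma nilpotent_potent (m : nat) x : (0 < m)%N ->
  (exists e b, [/\ potent m e, nilpotent_elt b, GRing.comm e b & x = e + b]) ->
  nilpotent_elt (x ^+ m - x).
Proof.
move=> m0 [e [b [em [k bk] ceb ->]]]; exists k.
have cE : GRing.comm (e + b) e.
  by apply/commr_sym/commrD => //; apply: commr_refl.
have -> : (e + b) ^+ m - (e + b) =
    b * (\sum_(i < m) (e + b) ^+ (m.-1 - i) * e ^+ i - 1).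
  have := subrXX_comm m cE; rewrite em [e + b - e]addrAC subrr add0r => H.
  by rewrite mulrBr mulr1 -H opprD addrA.
have cbE : GRing.comm b (e + b) by apply: commrD; [apply/commr_sym | apply: commr_refl].
rewrite exprMn_comm ?bk ?mul0r //.
apply: commrB; last exact: commr1.
apply: commr_sum => i _; apply: commrM; apply: commrX => //.
Qed.

(** Telescoping: x^(p^(c+1)) - x is the sum of (x^p)^(p^c) - x^(p^c), a multiple of x^p - x, and of
    x^(p^c) - x. *)
Lemma subrX_pfactor (p c : nat) x : exists w,
  GRing.comm x w /\ x ^+ (p ^ c) - x = (x ^+ p - x) * w.
Proof.
elim: c => [|c [w [cw IH]]].
  by exists 0; split; [apply: commr0 | rewrite expn0 expr1 subrr mulr0].
have cx n : GRing.comm x (x ^+ n) by apply: commrX; apply: commr_refl.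
exists (\sum_(i < p ^ c) (x ^+ p) ^+ ((p ^ c).-1 - i) * x ^+ i + w); split.
  apply: commrD => //; apply: commr_sum => i _; apply: commrM => //.
  by rewrite -exprM.
rewrite mulrDr -IH -subrXX_comm; last exact/commr_sym.
by rewrite -exprM -expnS addrA subrK.
Qed.

Section Idempotents.
Variables (I : finType) (E a : I -> R).
Hypothesis EC : forall i x, GRing.comm (E i) x.
Hypothesis EE : forall i j, E i * E j = if i == j then E i else 0.
Hypothesis E1 : \sum_i E i = 1.

Lemma sum_idempotentX (n : nat) :
  (\sum_i E i * a i) ^+ n = \sum_i E i * a i ^+ n.
Proof.
elim: n => [|n IH]; first by
  rewrite expr0 -E1; apply: eq_bigr => i _; rewrite expr0 mulr1.
rewrite exprS IH mulr_suml; apply: eq_bigr => i _.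
rewrite mulr_sumr (bigD1 i) //= big1 => [|j /negPf ne].
  by rewrite addr0 exprS mulrA -[E i * a i * E i]mulrA -EC mulrA EE eqxx mulrA.
by rewrite mulrA -[E i * a i * E j]mulrA -EC mulrA EE eq_sym ne !mul0r.
Qed.

Lemma sum_idempotent0 : (forall i, exists L, forall k, (L <= k)%N -> E i * a i ^+ k = 0) ->
  nilpotent_elt (\sum_i E i * a i).
Proof.
move=> /boolp.choice[L HL]; exists (\max_i L i).
by rewrite sum_idempotentX big1 // => i _; apply: HL; apply: leq_bigmax.
Qed.
End Idempotents.
End PthPowers.

(** * Chinese remainder idempotents *)

(** Represents the idempotent of Z/M that is 1 on the p-part and 0 on the prime-to-p part. *)
Definition crt_unit (M p : nat) : nat := chinese M`_p M`_p^' 1 0.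

Lemma crt_unit_modp (M p : nat) : (0 < M)%N -> crt_unit M p = 1 %[mod M`_p].
Proof. by move=> M0; rewrite chinese_modl // coprime_partC. Qed.

Lemma dvdn_crt_unit (M p : nat) : (0 < M)%N -> (M`_p^' %| crt_unit M p)%N.
Proof.
by move=> M0; rewrite /dvdn chinese_modr ?mod0n // coprime_partC.
Qed.

Lemma dvdn_part_crt_unit (M p q : nat) : (0 < M)%N -> p != q ->
  (M`_p %| crt_unit M q)%N.
Proof.
move=> M0 ne; apply: dvdn_trans (dvdn_crt_unit q M0).
by apply: sub_in_partn => r _ /eqP ->; rewrite !inE.
Qed.

Lemma eqn_mod_parts (M a b : nat) : (0 < M)%N ->
  (forall p, p \in primes M -> a = b %[mod M`_p]) -> a = b %[mod M].
Proof.
move=> M0; wlog le_ba : a b / (b <= a)%N => [W H|H].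
  by case/orP: (leq_total a b) => le; [symmetry|]; apply: W => // p /H.
apply/eqP; rewrite eqn_mod_dvd //; apply/dvdn_partP => // p pM.
by rewrite -eqn_mod_dvd //; apply/eqP/H.
Qed.

Section OrthogonalCrt.
Variables (R : pzRingType) (M : nat).
Hypothesis (M_gt0 : (0 < M)%N) (M0 : M%:R = 0 :> R).

Lemma natr_eq_mod (a b : nat) : a = b %[mod M] -> a%:R = b%:R :> R.
Proof.
move=> eq_ab; rewrite (divn_eq a M) (divn_eq b M) eq_ab.
by rewrite !natrD !natrM M0 !mulr0.
Qed.

Lemma crt_unit_orthogonal (p q : nat) : p \in primes M -> q \in primes M ->
  (crt_unit M p)%:R * (crt_unit M q)%:R
    = (if p == q then (crt_unit M p)%:R else 0) :> R.
Proof.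
move=> pM qM; rewrite -natrM -[0]/(0%:R) -(fun_if (fun n : nat => n%:R : R)).
apply/natr_eq_mod/eqn_mod_parts => // r _.
have unit0 s : r != s -> (crt_unit M s) = 0 %[mod M`_r].
  by move=> ne; apply/eqP; rewrite mod0n; apply: dvdn_part_crt_unit.
rewrite -modnMml; have [rp|/unit0 ep] := eqVneq r p; last first.
  by rewrite ep modnMml mul0n; case: eqP => // _; rewrite ep.
rewrite -rp crt_unit_modp // modnMml mul1n.
by have [<-|/unit0->] := eqVneq r q.
Qed.

Lemma sum_crt_unit :
  \sum_(i < size (primes M)) (crt_unit M (tnth (in_tuple (primes M)) i))%:R
    = 1 :> R.
Proof.
rewrite -natr_sum -[RHS]/(1%:R); apply: natr_eq_mod.
apply/eqn_mod_parts => // r /(tnthP (in_tuple _))[i ->].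
rewrite (bigD1 i) //= -modnDmr [X in (_ + X)%N](_ : _ = 0)%N.
  by rewrite addn0 crt_unit_modp.
apply/eqP; apply: (big_ind (fun n => _ %| n)%N) => // [|j ne]; first exact: dvdn_add.
apply: dvdn_part_crt_unit => //; apply: contra ne.
by rewrite eq_sym !(tnth_nth 0%N) nth_uniq ?primes_uniq // => /eqP/val_inj->.
Qed.

(** On each p-component the potent part is a power x^(p^c) that is fixed by the p-th power map; it
    is m-potent because p - 1 divides m - 1. *)
Lemma strongly_nil_clean_primes (m : nat) : (0 < m)%N ->
  (forall p, p \in primes M -> (p - 1 %| m - 1)%N) ->
  (forall (x : R) p, p \in primes M ->
     exists L, (x ^+ p - x) ^+ L *+ M`_p^' = 0) ->
  strongly_nil_clean R m.
Proof.
move=> m0 dvd_m nilM x.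
pose p i := tnth (in_tuple (primes M)) i.
pose E i : R := (crt_unit M (p i))%:R.
have pM i : p i \in primes M by apply: (mem_tnth i (in_tuple (primes M))).
have p_pr i : prime (p i) by have := pM i; rewrite mem_primes => /and3P[].
have EC i y : GRing.comm (E i) y by apply/commr_sym/commr_nat.
have E1 : \sum_i E i = 1 by apply: sum_crt_unit.
have EE i j : E i * E j = if i == j then E i else 0.
  rewrite /E crt_unit_orthogonal // /p !(tnth_nth 0%N) nth_uniq ?primes_uniq //.
have EX i n y : (0 < n)%N -> (E i * y) ^+ n = E i * y ^+ n.
  case: n => // n _; rewrite exprMn_comm //; congr (_ * _).
  by elim: n => [|n IH]; rewrite ?expr1 // exprS IH EE eqxx.
have Enil i y : exists L, E i * (y ^+ p i - y) ^+ L = 0.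
  have [L HL] := nilM y _ (pM i); exists L.
  have /dvdnP[d def_d] := dvdn_crt_unit (p i) M_gt0.
  by rewrite /E def_d natrM -mulrA [X in _ * X]mulr_natl HL mulr0.
(* On the p-component, x^p and x differ by a nilpotent element killed by a power of p, so their
   p^c-th powers agree for some c. *)
have stable i : exists c, E i * (x ^+ (p i ^ c)) ^+ p i = E i * x ^+ (p i ^ c).
  have defB : E i * x ^+ p i - E i * x = E i * (x ^+ p i - x) by rewrite mulrBr.
  have cEx : GRing.comm (E i * x ^+ p i) (E i * x).
    apply: commrM; first exact/commr_sym.
    apply/commr_sym; apply: commrM; first exact/commr_sym.
    by apply: commrX; apply: commr_refl.
  have [c /(_ c (leqnn c)) eq_c] : exists c0, forall c, (c0 <= c)%N ->
      (E i * x ^+ p i) ^+ (p i ^ c) = (E i * x) ^+ (p i ^ c).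
    apply: (expr_pfactor_stable (K := logn (p i) M)) => //; rewrite defB.
      have [L HL] := Enil i x; exists L.+1.
      by rewrite EX // exprSr mulrA HL mul0r.
    rewrite -p_part -mulr_natl mulrA -natrM.
    have /dvdnP[d ->] : (M %| M`_(p i) * crt_unit M (p i))%N.
      by rewrite -{1}(partnC (p i) M_gt0) dvdn_mul // dvdn_crt_unit.
    by rewrite natrM M0 mulr0 mul0r.
  exists c; rewrite !EX ?expn_gt0 ?prime_gt0 // in eq_c.
  by rewrite -exprM mulnC exprM.
have [c Hc] := boolp.choice stable.
pose e := \sum_i E i * x ^+ (p i ^ c i).
have comm_xe : GRing.comm x e.
  apply: commr_sum => i _; apply: commrM; first exact: commr_nat.
  by apply: commrX; apply: commr_refl.
exists e, (x - e); split.
- rewrite /potent /e sum_idempotentX //; apply: eq_bigr => i _.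
  have /dvdnP[j def_j] := dvd_m _ (pM i).
  (* Write m = 1 + j (p - 1): every further exponent p - 1 is absorbed, the p-th power map fixing
     the component. *)
  rewrite -[m](subnKC m0) def_j; elim: j {def_j} => [|j IH]; first by rewrite expr1.
  rewrite mulSn addnA subnKC ?prime_gt0 // exprD mulrA Hc -mulrA -exprS -add1n.
  exact: IH.
(* Each x - x^(p^c) is a multiple of x^p - x, hence nilpotent on its own component. *)
- have -> : x - e = \sum_i E i * (x - x ^+ (p i ^ c i)).
    by under eq_bigr do rewrite mulrBr; rewrite sumrB -mulr_suml E1 mul1r.
  apply: sum_idempotent0 => // i.
  have [w [cw def_w]] := subrX_pfactor (p i) (c i) x.
  have [L HL] := Enil i x; exists L => k leLk.
  rewrite -opprB def_w -mulrN exprMn_comm.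
    by rewrite -(subnKC leLk) exprD !mulrA HL !mul0r.
  apply: commrN; apply/commr_sym/commrB; last exact/commr_sym.
  by apply/commrX/commr_sym.
- by apply: commrB; [apply/commr_sym | apply: commr_refl].
- by rewrite addrC subrK.
Qed.
End OrthogonalCrt.

(** * Socle layers *)

Section TorsionElements.
Variable G : zmodType.
Implicit Types g h w : G.

Lemma mulrn_eq_mod (q a b : nat) g : g *+ q = 0 -> a = b %[mod q] ->
  g *+ a = g *+ b.
Proof.
move=> gq eq_ab; rewrite (divn_eq a q) (divn_eq b q) eq_ab !mulrnDr.
by rewrite ![(_ * q)%N]mulnC !mulrnA gq !mul0rn.
Qed.

Lemma mulrn_coprime (a b : nat) g : coprime a b -> g *+ a = 0 -> g *+ b = 0 ->
  g = 0.
Proof.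
move=> co_ab ga gb; have := chinese_modl co_ab 0 1; have := chinese_modr co_ab 0 1.
by move/(mulrn_eq_mod gb); rewrite mulr1n => <- /(mulrn_eq_mod ga)->.
Qed.

Lemma mulrn_invertible (p b : nat) : prime p -> ~~ (p %| b)%N ->
  exists v, forall g, g *+ p = 0 -> g *+ b *+ v = g.
Proof.
move=> p_pr pb; have b0 : (0 < b)%N by case: (b) pb; rewrite ?dvdn0.
have /coprimeP[//|[v w] /= vw] : coprime b p by rewrite coprime_sym prime_coprime.
exists v => g gp; rewrite -mulrnA mulnC.
have -> : (v * b = 1 + w * p)%N by rewrite -vw subnK // ltnW // -subn_gt0 vw.
by rewrite mulrnDr [(w * p)%N]mulnC mulrnA gp mul0rn addr0.
Qed.

Lemma mulrn_inv p k b g h : prime p -> ~~ (p %| b)%N ->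
  g *+ p = 0 -> g *+ b = h *+ p ^ k -> exists h', g = h' *+ p ^ k.
Proof.
move=> p_pr pb gp def_gb; have [v /(_ g gp) <-] := mulrn_invertible p_pr pb.
by exists (h *+ v); rewrite def_gb mulrnAC.
Qed.

(** A multiple of p^(logn p M) is killed by the prime-to-p part of M, and g is also killed by p. *)
Lemma bounded_height M p g h : (0 < M)%N -> (forall g, g *+ M = 0) -> prime p ->
  g *+ p = 0 -> g = h *+ p ^ logn p M -> g = 0.
Proof.
move=> M0 GM p_pr gp def_g; apply: (@mulrn_coprime p M`_p^'%N) => //.
  by rewrite prime_coprime // -p'natE // part_pnat.
by rewrite def_g -mulrnA -p_part partnC.
Qed.

Lemma endoXE (x : endo G) n g : (x ^+ n) g = iter n x g.
Proof. by elim: n => [|n IH] //; rewrite exprS endoME IH. Qed.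

Lemma endoMn (x : endo G) n g : (x *+ n) g = x g *+ n.
Proof. by elim: n => [|n IH] //; rewrite !mulrS endoDE IH. Qed.

Lemma endo_natr n g : (n%:R : endo G) g = g *+ n.
Proof. exact: endoMn. Qed.

(* (p^k G \cap G[p]) / (p^(k+1) G \cap G[p]) is generated by [w]; its dimension
   is the number of summands of order p^(k+1) in a cyclic decomposition. *)
Definition cyclic_layer (p k : nat) : Prop :=
  exists w, [/\ w *+ p = 0, exists h, w = h *+ p ^ k
    & forall g h, g *+ p = 0 -> g = h *+ p ^ k ->
        exists c h', g = w *+ c + h' *+ p ^ k.+1].

(** On the layer x acts as a scalar l, and l^p = l modulo p by Fermat, so x^p - x moves the socle
    one layer deeper. *)
Lemma cyclic_layer_shift (p k : nat) (x : endo G) g h : prime p -> cyclic_layer p k ->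
  g *+ p = 0 -> g = h *+ p ^ k -> exists h', (x ^+ p - x) g = h' *+ p ^ k.+1.
Proof.
move=> p_pr [w [wp [hw def_w] gen_w]] gp def_g.
have [c [h1 ->]] := gen_w _ _ gp def_g.
have [l [h2 xw]] : exists l h', x w = w *+ l + h' *+ p ^ k.+1.
  by apply: (gen_w _ (x hw)); rewrite -?raddfMn ?wp ?raddf0 // -def_w.
have xnw n : exists h', (x ^+ n) w = w *+ l ^ n + h' *+ p ^ k.+1.
  elim: n => [|n [h3 IH]]; first by exists 0; rewrite mul0rn addr0.
  exists (h2 *+ l ^ n + x h3); rewrite exprS endoME IH raddfD !raddfMn xw.
  by rewrite mulrnDl -mulrnA -expnS mulrnDl -!addrA -!mulrnA [(p ^ _ * _)%N]mulnC.
have [h3 xpw] := xnw p.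
exists ((h3 - h2) *+ c + (x ^+ p - x) h1).
rewrite raddfD !raddfMn endoDE endoNE xpw xw (mulrn_eq_mod wp (fermat_little l p_pr)).
rewrite opprD addrACA subrr add0r -mulrnBl mulrnAC.
by rewrite -mulrnDl.
Qed.

(** After K = [logn p M] shifts the socle G[p] is killed, so y^(K i) kills G[p^i]. Multiplication by
    the prime-to-p part of M maps G into G[p^K]. *)
Lemma cyclic_layers_nilpotent (M p : nat) (x : endo G) : (0 < M)%N -> prime p ->
  (forall g, g *+ M = 0) -> (forall k, cyclic_layer p k) ->
  exists L, (x ^+ p - x) ^+ L *+ M`_p^' = 0.
Proof.
move=> M0 p_pr GM layer; set y := x ^+ p - x; set K := logn p M.
have pK : (p ^ K = M`_p)%N by rewrite p_part.
have layerX j g : g *+ p = 0 -> exists h, (y ^+ j) g = h *+ p ^ j.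
  move=> gp; elim: j => [|j [h IH]]; first by exists g.
  rewrite exprS endoME; apply: cyclic_layer_shift IH => //.
  by rewrite -raddfMn gp raddf0.
have socle g : g *+ p = 0 -> (y ^+ K) g = 0.
  move=> gp; have [h def_h] := layerX K g gp.
  apply: bounded_height def_h => //.
  by rewrite -raddfMn gp raddf0.
have torsion i g : g *+ p ^ i = 0 -> (y ^+ (K * i)) g = 0.
  elim: i g => [|i IH] g gp; first by rewrite muln0.
  rewrite mulnS addnC exprD endoME; apply: IH.
  by rewrite -raddfMn socle // -mulrnA -expnSr.
exists (K * K)%N; apply/endoP => g; rewrite endoMn -raddfMn torsion //.
by rewrite -mulrnA pK mulnC partnC.
Qed.
End TorsionElements.

(** * Divisibility in ['Z_q] and the layers of a primary sum *)

Lemma Zp_natr_eq0 (q n : nat) : (1 < q)%N -> (n%:R == 0 :> 'Z_q) = (q %| n)%N.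
Proof. by move=> q1; rewrite -val_eqE /= val_Zp_nat. Qed.

Lemma Zp_mulrn_eq0 (q n : nat) (a : 'Z_q) : (1 < q)%N ->
  (a *+ n == 0) = (q %| a * n)%N.
Proof.
by move=> q1; rewrite -Zp_natr_eq0 // natrM mulr_natr natr_Zp.
Qed.

Lemma Zp_mulrn_card (q : nat) (a : 'Z_q) : (1 < q)%N -> a *+ q = 0.
Proof. by move=> q1; apply/eqP; rewrite Zp_mulrn_eq0 // dvdn_mull. Qed.

Lemma Zp_divisible (q d e : nat) (a : 'Z_q) : (1 < q)%N -> q = (d * e)%N ->
  a *+ e = 0 -> exists b : 'Z_q, a = b *+ d.
Proof.
move=> q1 def_q /eqP; rewrite Zp_mulrn_eq0 // {1}def_q dvdn_pmul2r.
  by move/divnK => def_a; exists (a %/ d)%:R; rewrite -mulrnA def_a natr_Zp.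
by apply: contraTT q1; rewrite lt0n negbK def_q => /eqP->; rewrite muln0.
Qed.

Section PrimarySum.
Variables (n : nat) (p : 'I_n -> nat) (t : 'I_n -> nat).
Variable k : forall i : 'I_n, 'I_(t i) -> nat.
Arguments k : clear implicits.
Hypothesis p_prime : forall i, prime (p i).
Hypothesis k_gt0 : forall i j, (0 < k i j)%N.
Local Notation H := (primary_sum p k).

Definition primary_order : nat := \prod_i \prod_j p i ^ k i j.

Lemma primary_factor_gt1 i j : (1 < p i ^ k i j)%N.
Proof. by rewrite -(exp1n (k i j)) ltn_exp2r ?prime_gt1. Qed.

Lemma dirsumMn (I : finType) (A : I -> zmodType) (x : dirsum A) m i :
  (x *+ m) i = x i *+ m.
Proof.
elim: m => [|m IH]; first by rewrite ffunE.
by rewrite !mulrS dirsumDE IH.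
Qed.

Lemma primary_sumP (x y : H) : (forall i j, x i j = y i j) -> x = y.
Proof. by move=> eq_xy; apply/ffunP => i; apply/ffunP => j. Qed.

Lemma primary_sumMn (x : H) m i j : (x *+ m) i j = x i j *+ m.
Proof. by rewrite !dirsumMn. Qed.

Lemma primary_order_gt0 : (0 < primary_order)%N.
Proof.
by apply: prodn_gt0 => i; apply: prodn_gt0 => j; rewrite ltnW ?primary_factor_gt1.
Qed.

Lemma primary_sum_bounded (x : H) : x *+ primary_order = 0.
Proof.
apply: primary_sumP => i j; rewrite !dirsumMn !ffunE.
rewrite /primary_order (bigD1 i) //= (bigD1 j) //= -mulnA mulrnA.
by rewrite Zp_mulrn_card ?mul0rn ?primary_factor_gt1.
Qed.

Lemma primes_primary_order P : P \in primes primary_order -> exists i, p i = P.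
Proof.
rewrite mem_primes => /and3P[P_pr _]; rewrite Euclid_dvd_prod // big_orE.
case/existsP=> i /=; rewrite Euclid_dvd_prod // big_orE => /existsP[j /=].
by rewrite Euclid_dvdX // => /andP[]; rewrite dvdn_prime2 // => /eqP-> _; exists i.
Qed.

Hypothesis p_inj : injective p.
Hypothesis k_inj : forall i, injective (k i).

(** As the exponents are distinct, at most one summand has order P^(K+1), and only its socle
    contributes to the layer. *)
Lemma primary_sum_cyclic_layer (P K : nat) : prime P -> cyclic_layer H P K.
Proof.
move=> P_pr; pose top i j := (p i == P) && (k i j == K.+1).
pose hw : H := [ffun i => [ffun j => (top i j)%:R : 'Z_(p i ^ k i j)] : dirsum _].
have hwE i j : hw i j = (top i j)%:R by rewrite !ffunE.
exists (hw *+ P ^ K); split; last 1 first.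
- move=> g h gP def_g.
  have [c Hc] : exists c, forall i j, exists b,
      g i j = (hw *+ P ^ K) i j *+ c + b *+ P ^ K.+1.
    have gijP i j : g i j *+ P = 0 by rewrite -primary_sumMn gP !ffunE.
    have gij i j : g i j = h i j *+ P ^ K by rewrite def_g primary_sumMn.
    have q1 i j : (1 < p i ^ k i j)%N by apply: primary_factor_gt1.
    (* Off the top summand the coordinate is 0 if the prime differs or the exponent is at most K;
       for a larger exponent the whole P-torsion consists of multiples of P^(K+1). *)
    have off i j : ~~ top i j -> exists b, g i j = b *+ P ^ K.+1.
      rewrite negb_and; have [pP /= kK|pP _] := eqVneq (p i) P; last first.
        exists 0; rewrite mul0rn; apply: (mulrn_coprime (a := P) (b := p i ^ k i j)) (gijP i j) _.
          by rewrite coprime_pexpr ?k_gt0 // prime_coprime // dvdn_prime2 // eq_sym.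
        exact: Zp_mulrn_card.
      have [lekK|ltKk] := leqP (k i j) K.
        exists 0; rewrite mul0rn gij -(subnKC lekK) expnD mulrnA -pP.
        by rewrite Zp_mulrn_card ?mul0rn.
      have ltKk' : (K.+1 <= (k i j).-1)%N by rewrite -ltnS prednK // ltn_neqAle eq_sym kK.
      have kP : (p i ^ k i j)%N = (P ^ (k i j).-1 * P)%N by rewrite -expnSr prednK // pP.
      have [b ->] := Zp_divisible (q1 i j) kP (gijP i j).
      by exists (b *+ P ^ ((k i j).-1 - K.+1)); rewrite -mulrnA -expnD subnK.
    have on i j : top i j -> exists c, g i j = (1 *+ P ^ K) *+ c.
      case/andP=> /eqP pP /eqP kK.
      have kP : (p i ^ k i j)%N = (P ^ K * P)%N by rewrite -expnSr kK pP.
      have [b ->] := Zp_divisible (q1 i j) kP (gijP i j).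
      by exists b; rewrite mulrnAC natr_Zp.
    have [[i0 [j0 top0]]|no_top] := pselect (exists i j, top i j).
      have [c Hc] := on _ _ top0; exists c => i j.
      rewrite primary_sumMn hwE; have [topij|/off[b ->]] := boolP (top i j); last first.
        by exists b; rewrite !mul0rn add0r.
      have [/andP[/eqP pi /eqP ki] /andP[/eqP pi0 /eqP ki0]] := (topij, top0).
      have eq_i : i0 = i by apply: p_inj; rewrite pi.
      subst i0; have eq_j : j0 = j by apply: (@k_inj i); rewrite ki.
      by subst j0; exists 0; rewrite mul0rn addr0.
    exists 0%N => i j; rewrite mulr0n.
    have [topij|/off[b ->]] := boolP (top i j); first by case: no_top; exists i, j.
    by exists b; rewrite add0r.
  pose b i j := projT1 (cid (Hc i j)).
  exists c, ([ffun i => [ffun j => b i j] : dirsum _] : H).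
  apply: primary_sumP => i j; rewrite !dirsumDE !dirsumMn !ffunE.
  rewrite {1}(projT2 (cid (Hc i j))) -/(b i j).
  by rewrite !dirsumMn !ffunE.
- apply: primary_sumP => i j; rewrite !dirsumMn hwE !ffunE -mulrnA -expnSr.
  case: (boolP (top i j)) => [/andP[/eqP pP /eqP kK]|_]; last by rewrite mul0rn.
  by rewrite -pP -kK Zp_mulrn_card ?primary_factor_gt1.
- by exists hw.
Qed.
End PrimarySum.

(** * Functionals with values in 'Z_q *)

Lemma additive_of (U V : zmodType) (f : U -> V) : zmod_morphism f ->
  exists F : {additive U -> V}, F =1 f.
Proof.
move=> fB; pose F := GRing.isZmodMorphism.Build U V f fB.
by exists (HB.pack f F : {additive U -> V}).
Qed.

(** Coefficients are natural numbers, so -n is represented by (q - 1) n, up to a multiple of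
    [c *+ q]. *)
Lemma opprMn_complement (U : zmodType) (q n : nat) (c : U) : (0 < q)%N ->
  - (c *+ n) = - (c *+ q *+ n) + c *+ (q.-1 * n).
Proof.
by case: q => // q _; rewrite mulrS mulrnDl opprD mulrnA addrNK.
Qed.

Section Extension.
Variables (G : zmodType) (q : nat).
Hypothesis q_gt1 : (1 < q)%N.
Local Notation V := (G * 'Z_q)%type.
Local Open Scope classical_set_scope.

(** Graph of a homomorphism to ['Z_q] defined on a subgroup containing qG and vanishing on qG. As
    graphs, partial maps in a chain glue by plain union. *)
Definition hom_graph (B : set V) : Prop :=
  [/\ forall a b, B a -> B b -> B (a - b), forall y, B (0, y) -> y = 0
    & forall g, B (g *+ q, 0)].

Section Graph.
Variable B : set V.
Hypothesis gB : hom_graph B.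

Lemma hom_graph0 : B 0.
Proof. by have [_ _ /(_ 0)] := gB; rewrite mul0rn. Qed.

Lemma hom_graphN a : B a -> B (- a).
Proof. by have [Bsub _ _] := gB => /(Bsub _ _ hom_graph0); rewrite sub0r. Qed.

Lemma hom_graphD a b : B a -> B b -> B (a + b).
Proof. by have [Bsub _ _] := gB => Ba /hom_graphN/(Bsub _ _ Ba); rewrite opprK. Qed.

Lemma hom_graphMn a n : B a -> B (a *+ n).
Proof.
move=> Ba; elim: n => [|n IH]; first exact: hom_graph0.
by rewrite mulrS; apply: hom_graphD.
Qed.

Lemma hom_graph_inj g y z : B (g, y) -> B (g, z) -> y = z.
Proof.
have [Bsub Bfun _] := gB => By Bz; apply/subr0_eq/Bfun.
by have := Bsub _ _ By Bz; rewrite -[_ - _]/(g - g, y - z) subrr.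
Qed.

Lemma pairMn (g : G) (y : 'Z_q) n : (g, y) *+ n = (g *+ n, y *+ n) :> V.
Proof. by elim: n => [|n IH] //; rewrite !mulrS IH. Qed.

(* Baer's criterion for 'Z_q: if [g *+ d] is the least multiple of [g] in the
   domain, then [d] divides [q] and the value at [g *+ d] is divisible by [d]. *)
Lemma hom_graph_extend (g : G) : (forall y, ~ B (g, y)) ->
  exists C, [/\ hom_graph C, B `<=` C & exists y, C (g, y)].
Proof.
move=> ndom; have [Bsub Bfun Bq] := gB.
pose D n := `[< (0 < n)%N /\ exists y, B (g *+ n, y) >].
have exD : exists n, D n.
  by exists q; apply/asboolP; split; [rewrite ltnW | exists 0].
case: (ex_minnP exD) => d /asboolP[d0 [y Bdy]] min_d.
have dvd_dom n z : B (g *+ n, z) -> (d %| n)%N.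
  move=> Bnz; rewrite /dvdn -leqn0 leqNgt; apply/negP => r0.
  suff /min_d : D (n %% d)%N by rewrite leqNgt ltn_mod d0.
  apply/asboolP; split=> //; exists (z - y *+ (n %/ d)).
  have := Bsub _ _ Bnz (hom_graphMn (n %/ d) Bdy); rewrite pairMn.
  rewrite -[_ - _]/(g *+ n - g *+ d *+ (n %/ d), z - y *+ (n %/ d)).
  by rewrite {1}(divn_eq n d) mulrnDr mulnC mulrnA addrAC subrr add0r.
have /dvdnP[e def_q] := dvd_dom q 0 (Bq g).
have ye : y *+ e = 0.
  apply: hom_graph_inj (Bq g).
  by rewrite [in g *+ q]def_q mulnC mulrnA -pairMn; apply: hom_graphMn.
have [|z def_y] := @Zp_divisible q d e y q_gt1 _ ye; first by rewrite mulnC.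
(* The new graph is B + Z (g, z) with d z = y. Natural n suffice, because q (g, z) = (q g, 0) lies
   in B. *)
exists [set u | exists b n, B b /\ u = b + (g, z) *+ n]; split.
- split.
  + move=> _ _ [b [n [Bb ->]]] [b' [n' [Bb' ->]]].
    exists (b - b' - (g, z) *+ q *+ n'), (n + q.-1 * n')%N; split.
      apply: (Bsub); first exact: Bsub.
      by apply: hom_graphMn; rewrite pairMn Zp_mulrn_card.
    rewrite opprD addrACA -!addrA; congr (_ + (_ + _)).
    by rewrite mulrnDr addrCA; congr (_ + _); rewrite -opprMn_complement // ltnW.
  (* If b + n (g, z) has first coordinate 0, then d divides n, so n (g, z) is a multiple of (d g, y)
     and lies in B; single-valuedness of B concludes. *)
  + move=> y' [[b1 b2] [n [Bb]]]; rewrite pairMn => -[/esym/eqP].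
    rewrite addr_eq0 => /eqP def_b1 ->.
    have Bn : B (g *+ n, - b2).
      by have := hom_graphN Bb; rewrite def_b1 -[- _]/(- - (g *+ n), - b2) opprK.
    have /dvdnP[j def_n] := dvd_dom _ _ Bn.
    have := hom_graphMn j Bdy; rewrite pairMn -!mulrnA mulnC -def_n => Bn'.
    by rewrite def_y -mulrnA mulnC -def_n in Bn'; rewrite -(hom_graph_inj Bn Bn') subrr.
  + by move=> h; exists (h *+ q, 0), 0%N; rewrite mulr0n addr0.
- by move=> b Bb; exists b, 0%N; rewrite mulr0n addr0.
- by exists z, 0, 1%N; split; [apply: hom_graph0 | rewrite add0r].
Qed.
End Graph.

Lemma hom_graph_total (A : set V) : hom_graph A ->
  exists f : {additive G -> 'Z_q}, forall g y, A (g, y) -> f g = y.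
Proof.
(* Zorn also requires P for the union of the empty chain; the guard [B !=set0] makes that case
   vacuous. *)
move=> gA; pose P (B : set V) := B !=set0 -> A `<=` B /\ hom_graph B.
have [F FP Ftot|B [PB maxB]] := @Zorn_bigcup V P.
  rewrite /P => -[u [B0 FB0 Bu]]; have [AB0 [_ _ qB0]] := FP _ FB0 (ex_intro _ u Bu).
  split; first by move=> a Aa; exists B0 => //; apply: AB0.
  split.
  - move=> a b [B FB Ba] [C FC Cb].
    have [BC|CB] := Ftot _ _ FB FC.
      have [_ [Csub _ _]] := FP _ FC (ex_intro _ b Cb).
      by exists C => //; apply: Csub => //; apply: BC.
    have [_ [Bsub _ _]] := FP _ FB (ex_intro _ a Ba).
    by exists B => //; apply: Bsub => //; apply: CB.
  - move=> y [B FB By]; have [_ [_ Bfun _]] := FP _ FB (ex_intro _ _ By).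
    exact: Bfun.
  - by move=> g; exists B0.
have B_n0 : B !=set0.
  apply: contrapT => B0; apply: (maxB A) => [|_]; last by split.
  split=> [b Bb|AB]; first by case: B0; exists b.
  by apply: B0; exists 0; apply: AB; apply: hom_graph0.
have [AB gB] := PB B_n0.
have total g : exists y, B (g, y).
  apply: contrapT => /forallNP ndom.
  have [C [gC BC [y Cy]]] := hom_graph_extend gB ndom.
  apply: (maxB C) => [|_]; last by split=> //; apply: subset_trans BC.
  by split=> // CB; apply: (ndom y); apply: CB.
have [f Bf] := boolp.choice total.
have fB : zmod_morphism f.
  move=> g h; apply: (hom_graph_inj gB (Bf _)).
  by have [Bsub _ _] := gB; apply: (Bsub _ _ (Bf g) (Bf h)).
have [F def_F] := additive_of fB; exists F => g y /AB Bgy.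
by rewrite def_F; apply: (hom_graph_inj gB (Bf _)).
Qed.
End Extension.

(** * Companion endomorphisms *)

Lemma Fp_prim_root (p : nat) : prime p ->
  exists z : 'F_p, (p - 1).-primitive_root z.
Proof.
move=> p_pr; have p1 := prime_gt1 p_pr.
have /hasP[z _ zP] : has (p - 1).-primitive_root [seq x <- enum 'F_p | x != 0].
  apply: has_prim_root; rewrite ?subn_gt0 //.
  - apply/allP=> x; rewrite mem_filter => /andP[x0 _]; rewrite unity_rootE.
    apply/eqP; apply: (mulfI x0); rewrite -exprS mulr1 subn1 prednK ?prime_gt0 //.
    by have := expf_card x; rewrite card_Fp.
  - by rewrite filter_uniq ?enum_uniq.
  - rewrite size_filter -(leq_add2r 1) subnK ?prime_gt0 //.
    rewrite -{1}(card_Fp p_pr) cardE -(count_predC (fun x : 'F_p => x != 0)) leq_add2l.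
    rewrite (eq_count (a2 := pred1 0)); last by move=> x /=; rewrite negbK.
    by rewrite count_uniq_mem ?enum_uniq // leq_b1.
by exists z.
Qed.

(** Take for a a primitive root z modulo p: z^m = z gives z^(m-1) = 1. *)
Lemma pred_prime_dvdn (p m : nat) : prime p -> (0 < m)%N ->
  (forall a, a ^ m = a %[mod p]) -> (p - 1 %| m - 1)%N.
Proof.
move=> p_pr m0 idm; have [z zP] := Fp_prim_root p_pr.
have z0 : z != 0.
  apply/eqP=> z0; have /eqP := prim_expr_order zP.
  by rewrite z0 expr0n subn_eq0 leqNgt prime_gt1 //= eq_sym oner_eq0.
rewrite (prim_order_dvd zP); apply/eqP; apply: (mulfI z0).
rewrite -exprS mulr1 subn1 prednK // -[z]natr_Zp -natrX; apply: val_inj => /=.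
by rewrite !val_Fp_nat.
Qed.

(* One of -1, 2, -2 is a square modulo [p]; in each case the companion matrix
   of X^2 - s X - u is a fourth root of -1. *)
Lemma companion_order8 (p : nat) : prime p -> p != 2%N -> exists u s : nat,
  (p %| u ^ 2 + s ^ 2 * u + 1)%N && (p %| s * u + u * s + s ^ 3)%N.
Proof.
move=> p_pr p2; have [z zP] := Fp_prim_root p_pr.
suff [u [s [E1 E2]]] : exists u s : 'F_p,
    u ^+ 2 + s ^+ 2 * u + 1 = 0 /\ s * u + u * s + s ^+ 3 = 0.
  exists u, s; have Fp0 n : (p %| n)%N = (n%:R == 0 :> 'F_p).
    by rewrite -(dvdn_pcharf (pchar_Fp p_pr)).
  by rewrite !Fp0 !(natrD, natrX, natrM) !natr_Zp E1 E2 eqxx.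
have two0 : 2%:R != 0 :> 'F_p.
  by rewrite -(dvdn_pcharf (pchar_Fp p_pr)) dvdn_prime2.
have root (a : 'F_p) : a != 0 -> exists i, a = z ^+ i.
  move=> a0; have [|i ->] := prim_rootP zP (x := a); last by exists i.
  apply: (mulfI a0); rewrite -exprS mulr1 subn1 prednK ?prime_gt0 //.
  by have := expf_card a; rewrite card_Fp.
have sqr i : ~~ odd i -> exists r : 'F_p, z ^+ i = r ^+ 2.
  by move=> ev; exists (z ^+ i./2); rewrite -exprM muln2 even_halfK.
have [|i def_i] := root (-1); first by rewrite oppr_eq0 oner_eq0.
have [j def_j] := root 2%:R two0.
have [odd_i|/sqr[r]] := boolP (odd i); last first.
  rewrite -def_i => def_r; exists r, 0; rewrite -def_r; split.
    by rewrite expr0n /= mul0r addr0 addNr.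
  by rewrite mul0r mulr0 expr0n !addr0.
have [odd_j|/sqr[r]] := boolP (odd j); last first.
  rewrite -def_j => def_r; exists (-1), r; rewrite [r ^+ 3]exprS -def_r; split.
    by rewrite sqrrN expr1n mulrN1 addrAC subrr.
  by rewrite mulrN1 mulN1r -opprD -mulr2n mulr_natr addNr.
(* Both -1 and 2 are odd powers of z here, so their product -2 is a square. *)
have [|r] := sqr (i + j)%N; first by rewrite oddD odd_i odd_j.
rewrite exprD -def_i -def_j mulN1r => def_r; exists 1, r.
rewrite [r ^+ 3]exprS -def_r expr1n !mulr1 mul1r; split.
  by rewrite addrAC subrr.
by rewrite -mulr2n mulrN mulr_natr subrr.
Qed.

(** * Endomorphisms of prescribed order on a layer *)

Section Layers.
Variables (G : zmodType) (m : nat).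
Hypothesis m_gt0 : (0 < m)%N.
Hypothesis nil_m : forall x : endo G, nilpotent_elt (x ^+ m - x).
Implicit Types (x : endo G) (g h : G).

Lemma endoX_fixed x g a n : (x ^+ a) g = g -> (x ^+ (a * n)) g = g.
Proof.
by move=> fix_a; elim: n => [|n IH]; rewrite ?muln0 // mulnS exprD endoME IH.
Qed.

Lemma endoX_fixed_gcd x g a b : (0 < a)%N -> (x ^+ a) g = g -> (x ^+ b) g = g ->
  (x ^+ gcdn a b) g = g.
Proof.
move=> a0 fix_a fix_b; have [km kn def_g _] := egcdnP b a0.
have := endoX_fixed km fix_a; rewrite mulnC def_g addnC exprD endoME.
by rewrite mulnC endoX_fixed.
Qed.

(** The p^c-th power of x = x^m - (x^m - x) gives x^(m p^c) = x^(p^c) up to a multiple of p, which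
    kills g. Since x^r fixes g, the power x^(p^c) can be cancelled. *)
Lemma endoX_fixed_frobenius p r x g : prime p -> g *+ p = 0 -> (0 < r)%N ->
  (x ^+ r) g = g -> exists c, (x ^+ ((m - 1) * p ^ c)) g = g.
Proof.
move=> p_pr gp r0 fix_r; have [c nil_c] := nil_m x; exists c.
have nil_q : (x ^+ m - x) ^+ (p ^ c) = 0.
  by rewrite -(subnK (ltnW (ltn_expl c (prime_gt1 p_pr)))) exprD nil_c mulr0.
have cx : GRing.comm (x ^+ m - x) x.
  by apply/commr_sym/commrB; [apply: commrX|]; apply: commr_refl.
have [z] := exprD_pfactor c p_pr cx.
rewrite subrK nil_q add0r -exprM => eq_x.
have fix_q : (x ^+ (r.-1 * p ^ c)) ((x ^+ (p ^ c)) g) = g.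
  by rewrite -endoME -exprD -mulSnr prednK // endoX_fixed.
have def_m : (m * p ^ c = (m - 1) * p ^ c + p ^ c)%N by rewrite -mulSnr subn1 prednK.
have fix_m : (x ^+ ((m - 1) * p ^ c)) ((x ^+ (p ^ c)) g) = (x ^+ (p ^ c)) g.
  by rewrite -endoME -exprD -def_m eq_x endoDE endoMn -raddfMn gp raddf0 addr0.
by rewrite -{1}fix_q -endoME -exprD addnC exprD endoME fix_m.
Qed.

Lemma mulrn_Zp_morphism q h : (1 < q)%N -> h *+ q = 0 ->
  zmod_morphism (fun a : 'Z_q => h *+ a).
Proof.
move=> q1 hq a b; apply/eqP; rewrite -subr_eq opprK -mulrnDr; apply/eqP.
apply: (mulrn_eq_mod hq); rewrite -!val_Zp_nat //; congr val.
by rewrite natrD !natr_Zp subrK.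
Qed.

(** Extends to G the map a h1 + b h2 + q g -> a modulo q; the independence hypothesis says exactly
    that it is well defined. *)
Lemma independent_functional q h1 h2 : (1 < q)%N -> h1 *+ q = 0 -> h2 *+ q = 0 ->
  (forall a b g, h1 *+ a + h2 *+ b = g *+ q -> (q %| a)%N) ->
  exists f : {additive G -> 'Z_q}, f h1 = 1 /\ f h2 = 0.
Proof.
move=> q1 hq1 hq2 indep.
pose A : set (G * 'Z_q) :=
  [set u | exists a b g, u = (h1 *+ a + h2 *+ b + g *+ q, a%:R)]%classic.
have q0 := ltnW q1.
have gA : hom_graph A.
  split.
  - move=> _ _ [a [b [g ->]]] [a' [b' [g' ->]]].
    exists (a + q.-1 * a')%N, (b + q.-1 * b')%N, (g - g').
    rewrite -[LHS]/(_ - _, _ - _); congr (_, _).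
      have := opprMn_complement a' h1 q0; have := opprMn_complement b' h2 q0.
      rewrite hq1 hq2 !mul0rn oppr0 !add0r => e2 e1.
      by rewrite !opprD addrACA [X in X + _]addrACA e1 e2 -!mulrnDr mulrnBl.
    have := opprMn_complement a' (1 : 'Z_q) q0.
    by rewrite Zp_mulrn_card // mul0rn oppr0 add0r natrD => ->.
  - move=> y [a [b [g [/esym/eqP]]]]; rewrite addr_eq0 -mulNrn => /eqP /indep.
    by rewrite -Zp_natr_eq0 // => /eqP-> ->.
  - by move=> g; exists 0%N, 0%N, g; rewrite !mulr0n !add0r.
have [f Hf] := hom_graph_total q1 gA; exists f; split; apply: Hf.
  by exists 1%N, 0%N, 0; rewrite mulr0n mul0rn !addr0.
by exists 0%N, 1%N, 0; rewrite mulr0n mul0rn addr0 add0r.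
Qed.

Section Pair.
Variables (p k : nat) (g1 g2 h1 h2 : G).
Hypotheses (p_prime : prime p) (g1p : g1 *+ p = 0) (g2p : g2 *+ p = 0).
Hypotheses (def_g1 : g1 = h1 *+ p ^ k) (def_g2 : g2 = h2 *+ p ^ k).
Hypothesis g1_out : forall h, g1 <> h *+ p ^ k.+1.
Hypothesis g2_out : forall c h, g2 <> g1 *+ c + h *+ p ^ k.+1.

Lemma pair_independent_socle a b h : g1 *+ a + g2 *+ b = h *+ p ^ k.+1 ->
  (p %| a)%N && (p %| b)%N.
Proof.
move=> eq_ab; have [pb|pb] := boolP (p %| b)%N; last first.
  have [v /(_ g2 g2p) g2v] := mulrn_invertible G p_prime pb.
  (* With v inverse to b on p-torsion, g2 = -(a v) g1 + p^(k+1) (h v), and (p - 1) a v stands for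
     -(a v). *)
  case: (g2_out (c := (p.-1 * (a * v))%N) (h := h *+ v)).
  have := opprMn_complement (a * v) g1 (prime_gt0 p_prime).
  rewrite g1p mul0rn oppr0 add0r => <-.
  by rewrite mulrnAC -eq_ab mulrnDl g2v mulrnA addKr.
rewrite andbT; apply: contraT => pa.
have g2b : g2 *+ b = 0 by case/dvdnP: pb => d ->; rewrite mulnC mulrnA g2p mul0rn.
rewrite g2b addr0 in eq_ab.
by have [h' /g1_out] := mulrn_inv p_prime pa g1p eq_ab.
Qed.

(** Once p^r divides a and b, with r <= k, scaling the relation by p^(k-r) turns it into a relation
    between g1 and g2 with coefficients a / p^r and b / p^r, which yields one more factor p. *)
Lemma pair_independent a b h : h1 *+ a + h2 *+ b = h *+ p ^ k.+1 ->
  (p ^ k.+1 %| a)%N && (p ^ k.+1 %| b)%N.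
Proof.
move=> eq_ab.
suff H r : (r <= k.+1)%N -> (p ^ r %| a)%N && (p ^ r %| b)%N by apply: H.
elim: r => [|r IH] ltrk; first by rewrite !dvd1n.
have /andP[/dvdnP[a' def_a] /dvdnP[b' def_b]] := IH (ltnW ltrk).
have /pair_independent_socle : g1 *+ a' + g2 *+ b' = (h *+ p ^ (k - r)) *+ p ^ k.+1.
  have split_k : (p ^ k = p ^ r * p ^ (k - r))%N by rewrite -expnD subnKC.
  rewrite mulrnAC -eq_ab def_a def_b def_g1 def_g2 mulrnDl -!mulrnA split_k.
  by congr (_ *+ _ + _ *+ _); rewrite mulnC mulnA.
rewrite def_a def_b expnS => /andP[pa pb].
by rewrite !dvdn_mul.
Qed.

(** With functionals f1, f2 dual to h1, h2, take x(g) = f1(g) h2 + f2(g) (u h1 + s h2). *)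
Lemma companion_endo (u s : nat) : exists x : endo G,
  x g1 = g2 /\ x g2 = g1 *+ u + g2 *+ s.
Proof.
set q := (p ^ k.+1)%N.
have q1 : (1 < q)%N by rewrite -(exp1n k.+1) ltn_exp2r ?prime_gt1.
have hq1 : h1 *+ q = 0 by rewrite /q expnSr mulrnA -def_g1.
have hq2 : h2 *+ q = 0 by rewrite /q expnSr mulrnA -def_g2.
have [a b g /pair_independent/andP[] //|f1 [f11 f12]] :=
  independent_functional q1 hq1 hq2.
have [a b g|f2 [f22 f21]] := independent_functional q1 hq2 hq1.
  by rewrite addrC => /pair_independent/andP[].
have hq : (h1 *+ u + h2 *+ s) *+ q = 0.
  by rewrite mulrnDl ![_ *+ _ *+ q]mulrnAC hq1 hq2 !mul0rn addr0.
have [x def_x] : exists x : {additive G -> G},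
    x =1 (fun g => h2 *+ f1 g + (h1 *+ u + h2 *+ s) *+ f2 g).
  apply: additive_of => g h; rewrite !raddfB.
  by rewrite (mulrn_Zp_morphism q1 hq2) (mulrn_Zp_morphism q1 hq) opprD addrACA.
have val1 : nat_of_ord (1 : 'Z_q) = 1%N by rewrite -[1]/(1%:R) val_Zp_nat ?modn_small.
exists x; rewrite def_g1 def_g2 !raddfMn !def_x f11 f12 f22 f21 val1 /=; split.
  by rewrite mulr1n mulr0n addr0.
by rewrite mulr0n add0r mulr1n mulrnDl ![_ *+ _ *+ (p ^ k)]mulrnAC.
Qed.
End Pair.

Hypothesis m_mod3 : ~~ (3 %| m - 1)%N.
Hypothesis m_mod8 : ~~ (8 %| m - 1)%N.

Lemma all_layers_cyclic p k : prime p -> cyclic_layer G p k.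
Proof.
move=> p_pr; apply: contrapT => not_cyclic.
(* That w = 0 does not generate the layer gives g1; that w = g1 does not gives g2, independent of
   g1. *)
have [g1 [h1 [g1p def_g1 g1_out]]] : exists g1 h1,
    [/\ g1 *+ p = 0, g1 = h1 *+ p ^ k & forall h, g1 <> h *+ p ^ k.+1].
  apply: contrapT => none; apply: not_cyclic; exists 0; split.
  - by rewrite mul0rn.
  - by exists 0; rewrite mul0rn.
  - move=> g h gp def_g; exists 0%N; apply: contrapT => /forallNP out.
    apply: none; exists g, h; split=> // h' def_g'.
    by apply: (out h'); rewrite mulr0n add0r.
have [g2 [h2 [g2p def_g2 g2_out]]] : exists g2 h2, [/\ g2 *+ p = 0,
    g2 = h2 *+ p ^ k & forall c h, g2 <> g1 *+ c + h *+ p ^ k.+1].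
  apply: contrapT => none; apply: not_cyclic; exists g1; split=> //.
  - by exists h1.
  - move=> g h gp def_g; apply: contrapT => out.
    apply: none; exists g, h; split=> // c h' def_g'.
    by apply: out; exists c, h'.
have g1_n0 : g1 <> 0 by move=> g0; apply: (g1_out 0); rewrite mul0rn.
have companion := companion_endo p_pr g1p g2p def_g1 def_g2 g1_out g2_out.
have [p2|p2] := eqVneq p 2%N.
  (* For p = 2 the companion matrix of X^2 + X + 1 has order 3, which is coprime to (m - 1) 2^c; so
     x fixes g1 and g2 = g1. *)
  have [x [x1 x2]] := companion 1%N 1%N; rewrite !mulr1n in x2.
  have fix3 : (x ^+ 3) g1 = g1.
    rewrite endoXE /= x1 x2 raddfD x1 x2 addrCA -mulr2n -p2 g2p addr0 //.
  have [c fixc] := endoX_fixed_frobenius p_pr g1p (ltn0Sn 2) fix3.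
  have := endoX_fixed_gcd (ltn0Sn 2) fix3 fixc.
  have /eqP-> : coprime 3 ((m - 1) * p ^ c).
    rewrite coprimeMr prime_coprime // m_mod3 p2.
    by case: c {fixc} => // c; rewrite coprime_pexpr.
  rewrite endoXE /= x1 => def_g2'.
  by apply: (g2_out 1%N 0); rewrite mul0rn addr0.
have [u [s /andP[pus1 pus2]]] := companion_order8 p_pr p2.
have [x [x1 x2]] := companion u s.
have x4 : (x ^+ 4) g1 = - g1.
  apply/eqP; rewrite -subr_eq0 opprK.
  have -> : (x ^+ 4) g1 + g1 =
      g1 *+ (u ^ 2 + s ^ 2 * u + 1) + g2 *+ (s * u + u * s + s ^ 3).
    have xab a b : x (g1 *+ a + g2 *+ b) = g1 *+ (u * b) + g2 *+ (a + s * b).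
      by rewrite raddfD !raddfMn x1 x2 mulrnDl -!mulrnA addrCA -mulrnDr.
    rewrite endoXE /= x1 x2 !xab addrAC [in RHS]mulrnDr mulr1n.
    congr (_ *+ _ + _ + _ *+ _); first by rewrite mulnDr !mulnn [(u * _)%N]mulnC.
    by rewrite mulnDr addnA [(u * s)%N]mulnC.
  case/dvdnP: pus1 => d1 ->; case/dvdnP: pus2 => d2 ->.
  by rewrite ![(_ * p)%N]mulnC !mulrnA g1p g2p !mul0rn addr0.
have fix8 : (x ^+ 8) g1 = g1.
  by rewrite (exprD x 4 4) endoME x4 raddfN x4 opprK.
have [c fixc] := endoX_fixed_frobenius p_pr g1p (ltn0Sn 7) fix8.
have fixgcd := endoX_fixed_gcd (ltn0Sn 7) fix8 fixc.
(* As p is odd and 8 does not divide m - 1, the gcd is a proper divisor of 8. Then x^4 fixes g1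
   while x^4 g1 = -g1, so 2 g1 = 0 and g1 = 0. *)
have : (gcdn 8 ((m - 1) * p ^ c) %| 4)%N.
  have /(@dvdn_pfactor 2 _ 3 isT)[j] := dvdn_gcdl 8 ((m - 1) * p ^ c).
  rewrite leq_eqVlt => /orP[/eqP->|ltj] gcd8; last first.
    by rewrite gcd8 (@dvdn_exp2l 2 j 2).
  case/negP: m_mod8; have := dvdn_gcdr 8 ((m - 1) * p ^ c).
  rewrite gcd8 Gauss_dvdl // (@coprime_pexpl 3 2) // coprimeXr //.
  by rewrite prime_coprime // dvdn_prime2 // eq_sym.
case/dvdnP=> d def4; apply: g1_n0; apply: (mulrn_coprime (a := 2) _ _ g1p).
  by rewrite prime_coprime // dvdn_prime2 // eq_sym.
have := endoX_fixed d fixgcd; rewrite mulnC -def4 x4 => eq_g1.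
by rewrite mulr2n -{1}eq_g1 addNr.
Qed.
End Layers.

(** * Decomposition into cyclic groups *)

Section PBasis.
Variables (G : zmodType) (p : nat) (J : finType) (K : J -> nat) (h : J -> G).
Hypotheses (p_prime : prime p) (K_inj : injective K).
Hypothesis h_order : forall j, h j *+ p ^ (K j).+1 = 0.

Section Independence.
Hypothesis h_top : forall j g, h j *+ p ^ K j <> g *+ p ^ (K j).+1.

(** Induction on the height [K j]: terms of smaller height vanish, and those of larger height lie in
    p^(K j + 1) G. If p did not divide [d j], the top multiple of [h j] would lie there too. *)
Lemma pbasis_free_socle (d : J -> nat) :
  \sum_j h j *+ p ^ K j *+ d j = 0 -> forall j, (p %| d j)%N.
Proof.
move=> sum0 j; move: {2}(K j) (leqnn (K j)) => n.
elim/ltn_ind: n j => n IH j le_jn; apply: contraT => pd.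
have [y def_y] : exists y, \sum_(i | i != j) h i *+ p ^ K i *+ d i = y *+ p ^ (K j).+1.
  apply: (big_ind (fun g => exists y, g = y *+ p ^ (K j).+1)).
  - by exists 0; rewrite mul0rn.
  - by move=> _ _ [y ->] [z ->]; exists (y + z); rewrite mulrnDl.
  move=> i ne_ij; have [ltij|gtij|/K_inj e] := ltngtP (K i) (K j); last first.
  - by rewrite e eqxx in ne_ij.
  - exists (h i *+ p ^ (K i - (K j).+1) *+ d i).
    by rewrite [RHS]mulrnAC -[h i *+ _ *+ _ ^ _]mulrnA -expnD subnK.
  have /dvdnP[e ->] := IH _ (leq_trans ltij le_jn) i (leqnn _).
  by exists 0; rewrite mul0rn mulnC mulrnA -[h i *+ _ *+ p]mulrnA -expnSr h_order mul0rn.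
have socle_j : h j *+ p ^ K j *+ p = 0 by rewrite -mulrnA -expnSr.
have [|g /h_top//] := mulrn_inv (k := (K j).+1) (h := - y) p_prime pd socle_j.
rewrite mulNrn -def_y; apply/eqP; rewrite -addr_eq0; apply/eqP.
by move: sum0; rewrite (bigD1 j).
Qed.

(** The divisibility is clear after scaling by a large p^a; a is then lowered one by one, each
    scaled relation being a relation in the socle. *)
Lemma pbasis_free (c : J -> nat) :
  \sum_j h j *+ c j = 0 -> forall j, (p ^ (K j).+1 %| c j)%N.
Proof.
move=> sum0.
suff H a : (forall j, p ^ (K j).+1 %| p ^ a * c j)%N ->
    forall j, (p ^ (K j).+1 %| c j)%N.
  apply: (H (\sum_i (K i).+1)) => i; apply: dvdn_mulr.
  by rewrite dvdn_exp2l // (bigD1 i) //= leq_addr.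
elim: a => [|a IH] dvd_a; first by move=> j; have := dvd_a j; rewrite mul1n.
apply: IH => j.
have def_d i : (p ^ a * c i = p ^ K i * ((p ^ a * c i) %/ p ^ K i))%N.
  rewrite [RHS]mulnC divnK // -(@dvdn_pmul2l p) ?prime_gt0 // -expnS mulnA -expnS.
  exact: dvd_a.
rewrite def_d expnSr dvdn_pmul2l ?expn_gt0 ?prime_gt0 //.
apply: pbasis_free_socle (fun i => (p ^ a * c i) %/ p ^ K i)%N _ j.
under eq_bigr do rewrite -mulrnA -def_d mulnC mulrnA.
by rewrite sumrMnl sum0 mul0rn.
Qed.
End Independence.

Definition spanned g := exists c : J -> nat, g = \sum_j h j *+ c j.

Section Spanning.
Variable r0 : nat.
Hypothesis h_span : forall k (g g' : G), g *+ p = 0 -> g = g' *+ p ^ k ->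
  exists c y, g = (\sum_(j | K j == k) h j *+ c) *+ p ^ k + y *+ p ^ k.+1.
Hypothesis height : forall g g' : G, g *+ p = 0 -> g = g' *+ p ^ r0 -> g = 0.

Let spanned0 : spanned 0.
Proof. by exists (fun=> 0%N); rewrite big1. Qed.

Let spannedD g g' : spanned g -> spanned g' -> spanned (g + g').
Proof.
move=> [c ->] [d ->]; exists (fun j => c j + d j)%N.
by rewrite -big_split; apply: eq_bigr => j _; rewrite mulrnDr.
Qed.

Let spannedMn g n : spanned g -> spanned (g *+ n).
Proof. by move=> sg; elim: n => [|n IH] //; rewrite mulrS; apply: spannedD. Qed.

Let spanned_gen j : spanned (h j).
Proof.
exists (fun i => (i == j) : nat); rewrite (bigD1 j) //= big1 ?eqxx ?addr0 //.
by move=> i /negPf->.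
Qed.

(** Removing the layer-k component of g leaves a socle element of height k + 1; the process ends at
    height r0, where the socle is zero. *)
Lemma pbasis_span_socle k g g' : g *+ p = 0 -> g = g' *+ p ^ k ->
  exists2 a, spanned a & g = a *+ p ^ k.
Proof.
move: {2}(r0 - k)%N (leqnn (r0 - k)) => n.
elim: n k g g' => [|n IH] k g g' len gp def_g.
  exists 0 => //; rewrite mul0rn; apply: (height (g' := g' *+ p ^ (k - r0)) gp).
  by rewrite leqn0 subn_eq0 in len; rewrite def_g -mulrnA -expnD subnK.
have [c [y def_g2]] := h_span gp def_g.
set b := \sum_(j | _) _ in def_g2.
have bp : b *+ p ^ k.+1 = 0.
  by rewrite -sumrMnl big1 // => j /eqP<-; rewrite mulrnAC h_order mul0rn.
have sb : spanned b by apply: big_ind => // j _; apply/spannedMn/spanned_gen.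
have [||a sa def_a] := IH k.+1 (y *+ p ^ k.+1) y _ _ (erefl _).
- by rewrite subnS -subn1 leq_subLR add1n.
- by move: gp; rewrite def_g2 mulrnDl -[b *+ _ *+ _]mulrnA -expnSr bp add0r.
exists (b + a *+ p); first by apply: spannedD => //; apply: spannedMn.
by rewrite def_g2 def_a mulrnDl -[a *+ p *+ _]mulrnA -expnS.
Qed.

(** If p^(r+1) kills g, then p^r g is a socle element, so it equals p^r a with a spanned; the
    difference g - a is killed by p^r. *)
Lemma pbasis_span r g : g *+ p ^ r = 0 -> spanned g.
Proof.
elim: r g => [|r IH] g gp; first by rewrite -[g]mulr1n -(expn0 p) gp.
have [|a sa def_a] := pbasis_span_socle (g := g *+ p ^ r) _ (erefl _).
  by rewrite -mulrnA -expnSr.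
rewrite -[g](subrK a); apply: spannedD => //; apply: IH.
by rewrite mulrnBl def_a subrr.
Qed.
End Spanning.
End PBasis.

(** * From a basis to a direct sum of cyclic groups *)

Lemma zmod_isog_sym (G H : zmodType) (f : {additive H -> G}) :
  bijective f -> zmod_isog G H.
Proof.
move=> [g fK gK]; have gB : zmod_morphism g.
  by move=> x y; apply: (can_inj fK); rewrite raddfB !gK.
have [F def_F] := additive_of gB; exists F.
by exists f => x; rewrite def_F ?gK ?fK.
Qed.

Section BasisIsomorphism.
Variables (G : zmodType) (M n : nat) (p : 'I_n -> nat) (t : 'I_n -> nat).
Variables (k : forall i : 'I_n, 'I_(t i) -> nat) (h : forall i : 'I_n, 'I_(t i) -> G).
Arguments k : clear implicits.
Arguments h : clear implicits.
Hypotheses (M_gt0 : (0 < M)%N) (p_prime : forall i, prime (p i)) (p_inj : injective p).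
Hypothesis k_gt0 : forall i j, (0 < k i j)%N.
Hypothesis k_le : forall i j, (k i j <= logn (p i) M)%N.
Hypothesis h_order : forall i j, h i j *+ p i ^ k i j = 0.
Hypothesis h_free : forall i c, \sum_j h i j *+ c j = 0 ->
  forall j, (p i ^ k i j %| c j)%N.
Hypothesis h_span : forall g, exists c : forall i, 'I_(t i) -> nat,
  g = \sum_i \sum_j h i j *+ c i j.

Lemma basis_isog : zmod_isog G (primary_sum p k).
Proof.
have q1 i j : (1 < p i ^ k i j)%N by apply: primary_factor_gt1.
have [F def_F] : exists F : {additive primary_sum p k -> G},
    F =1 (fun x => \sum_i \sum_j h i j *+ x i j).
  apply: additive_of => x y; rewrite -sumrB; apply: eq_bigr => i _.
  rewrite -sumrB; apply: eq_bigr => j _.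
  by rewrite -(mulrn_Zp_morphism (q1 i j) (h_order j)) !ffunE.
have F_inj : injective F.
  apply: raddf_inj => x; rewrite def_F => sum0; apply: primary_sumP => i j.
  rewrite !ffunE; suff : (p i ^ k i j %| x i j)%N.
    by rewrite -Zp_natr_eq0 // natr_Zp => /eqP.
  apply: (h_free (c := fun j => x i j)) => {j}.
  (* Multiplying by [crt_unit M (p i)] isolates the relation among the generators for [p i], to
     which freeness applies. *)
  have h_part i' j : h i' j *+ M`_(p i')%N = 0.
    rewrite p_part -(subnKC (k_le j)) expnD mulrnA h_order mul0rn //.
  have := congr1 (fun g => g *+ crt_unit M (p i)) sum0.
  rewrite mul0rn (bigD1 i) //= mulrnDl -[X in _ + X]sumrMnl.
  rewrite [X in _ + X]big1 => [|i' ne]; last first.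
    have /dvdnP[d ->] : (M`_(p i') %| crt_unit M (p i))%N.
      by apply: dvdn_part_crt_unit => //; apply: contra ne => /eqP/p_inj->.
    rewrite -sumrMnl big1 // => j _.
    by rewrite mulnC mulrnA [h i' j *+ _ *+ _]mulrnAC h_part !mul0rn.
  rewrite addr0 (mulrn_eq_mod _ (crt_unit_modp (p i) M_gt0)) ?mulr1n //.
  by rewrite -sumrMnl big1 // => j _; rewrite mulrnAC h_part mul0rn.
have F_surj g : exists x, F x = g.
  have [c ->] := h_span g.
  exists ([ffun i => [ffun j => (c i j)%:R] : dirsum _] : primary_sum p k).
  rewrite def_F; apply: eq_bigr => i _; apply: eq_bigr => j _; rewrite !ffunE.
  by apply: (mulrn_eq_mod (h_order j)); rewrite val_Zp_nat ?modn_mod.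
apply: (@zmod_isog_sym _ _ F); have [f fK] := boolp.choice F_surj.
by exists f => // x; apply: F_inj; rewrite fK.
Qed.
End BasisIsomorphism.

Section Decomposition.
Variables (G : zmodType) (M : nat).
Hypotheses (M_gt0 : (0 < M)%N) (GM : forall g : G, g *+ M = 0).
Hypothesis layers : forall p k, prime p -> cyclic_layer G p k.

(** The multiple p^k h is a socle element representing a nonzero class of the layer at height k. *)
Definition layer_generator (p k : nat) (h : G) : Prop :=
  h *+ p ^ k.+1 = 0 /\ forall g, h *+ p ^ k <> g *+ p ^ k.+1.

(** The layer is spanned by some w, and p^k h is c0 w modulo p^(k+1) G with p not dividing c0;
    inverting c0 replaces w by p^k h. *)
Lemma layer_generatorP p k h : prime p -> layer_generator p k h ->
  forall g g', g *+ p = 0 -> g = g' *+ p ^ k ->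
  exists c y, g = h *+ c *+ p ^ k + y *+ p ^ k.+1.
Proof.
move=> p_pr [h_order h_top] g g' gp def_g.
have [w [wp _ gen_w]] := layers k p_pr.
have hp : h *+ p ^ k *+ p = 0 by rewrite -mulrnA -expnSr.
have [c0 [y0 def_h]] := gen_w _ _ hp (erefl _).
have [c [y ->]] := gen_w _ _ gp def_g.
have [pc0|pc0] := boolP (p %| c0)%N.
  case: (h_top y0); rewrite def_h; case/dvdnP: pc0 => d ->.
  by rewrite mulnC mulrnA wp mul0rn add0r.
have [v /(_ w wp) wv] := mulrn_invertible G p_pr pc0.
have def_w : w = h *+ v *+ p ^ k - y0 *+ v *+ p ^ k.+1.
  by rewrite ![_ *+ v *+ _]mulrnAC -mulrnBl def_h addrK wv.
exists (v * c)%N, (y - y0 *+ v *+ c).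
by rewrite {1}def_w !mulrnBl mulrnA ![_ *+ c *+ _]mulrnAC -addrA [- _ + _]addrC.
Qed.

Lemma bounded_decomposition : exists (n : nat) (p : n.-tuple nat) (t : 'I_n -> nat)
    (k : forall i : 'I_n, 'I_(t i) -> nat),
  [/\ uniq p,
      forall i, [/\ prime (tnth p i), (0 < t i)%N & exists2 g : G, g *+ tnth p i = 0 & g <> 0],
      (forall i j, (0 < k i j)%N) /\ (forall i, injective (k i))
    & zmod_isog G (primary_sum (tnth p) k)].
Proof.
have /boolp.choice[H HP] (pk : nat * nat) : exists h : G,
    (exists h, layer_generator pk.1 pk.2 h) -> layer_generator pk.1 pk.2 h.
  have [[h hP]|no] := pselect (exists h, layer_generator pk.1 pk.2 h).
    by exists h.
  by exists 0 => ex; case: no.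
pose top p k := `[< exists h, layer_generator p k h >].
(* Heights of the nonzero layers, all below [logn p M]; height k yields a summand of order
   p^(k+1). *)
pose ks p := [seq k <- iota 0 (logn p M) | top p k].
(* Prime factors of M without p-torsion in G have no nonzero layer and are dropped. *)
pose ps := [seq p <- primes M | ks p != [::]].
pose p := tnth (in_tuple ps).
pose t i := size (ks (p i)).
pose kk q (j : 'I_(size (ks q))) := nth 0%N (ks q) j.
have kk_in q j : kk q j \in ks q by apply: mem_nth.
have kkP q j : layer_generator q (kk q j) (H (q, kk q j)).
  have := kk_in q j.
  by rewrite mem_filter => /andP[/asboolP/(HP (q, kk q j))].
have kk_inj q : injective (kk q).
  move=> j j' /eqP; rewrite nth_uniq ?filter_uniq ?iota_uniq // => /eqP.
  exact: val_inj.
have pP i : p i \in primes M /\ ks (p i) != [::].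
  have : p i \in ps by apply: mem_tnth.
  by rewrite mem_filter => /andP[].
have p_pr i : prime (p i) by have [] := pP i; rewrite mem_primes => /and3P[].
have ps_uniq : uniq ps by rewrite filter_uniq ?primes_uniq.
exists (size ps), (in_tuple ps), t, (fun i j => (kk (p i) j).+1); split.
- exact: ps_uniq.
- move=> i; have [_ ks_n0] := pP i; have t_gt0 : (0 < t i)%N by rewrite lt0n size_eq0.
  split=> //; have [h_order h_top] := kkP (p i) (Ordinal t_gt0).
  exists (H (p i, kk (p i) (Ordinal t_gt0)) *+ p i ^ kk (p i) (Ordinal t_gt0)).
    by rewrite -mulrnA -expnSr.
  by move=> h0; apply: (h_top 0); rewrite h0 mul0rn.
- by split=> // i j j' [/kk_inj].
have span q g r : prime q -> g *+ q ^ r = 0 ->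
    exists c, g = \sum_j H (q, kk q j) *+ c j.
  move=> q_pr gr; apply: (@pbasis_span _ q _ (kk q) _ _ (logn q M) _ _ r) => //.
  - by move=> j; have [] := kkP q j.
  - move=> k g1 g' gp def_g.
    have [/(HP (q, k)) /= gen_k|no_gen] := pselect (exists h, layer_generator q k h).
      have k_lt : (k < logn q M)%N.
        rewrite ltnNge; apply/negP => le_k; have [h_order h_top] := gen_k.
        apply: (h_top 0); rewrite mul0rn.
        apply: (bounded_height (h := H (q, k) *+ q ^ (k - logn q M)) M_gt0 GM q_pr).
          by rewrite -mulrnA -expnSr.
        by rewrite -mulrnA -expnD subnK.
      have k_in : k \in ks q.
        by rewrite mem_filter mem_iota /= k_lt andbT; apply/asboolP; exists (H (q, k)).
      have k_idx : (index k (ks q) < size (ks q))%N by rewrite index_mem.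
      have kk_idx : kk q (Ordinal k_idx) = k by rewrite /kk nth_index.
      have [c [y def_g1]] := layer_generatorP (q_pr) gen_k gp def_g.
      exists c, y; rewrite (big_pred1 (Ordinal k_idx)) ?kk_idx // => j /=.
      by rewrite -{1}kk_idx (inj_eq (@kk_inj q)).
    (* Otherwise g' itself would be a generator of this layer. *)
    have [y def_y] : exists y, g1 = y *+ q ^ k.+1.
      apply: contrapT => /forallNP no_y; apply: no_gen; exists g'; split.
        by rewrite expnSr mulrnA -def_g.
      by move=> y; rewrite -def_g; apply: no_y.
    by exists 0%N, y; rewrite big1 ?mul0rn ?add0r // => j _; rewrite mulr0n.
  - by move=> g1 g'; apply: bounded_height.
apply: (@basis_isog G M _ p t _ (fun i j => H (p i, kk (p i) j))) => //.
- move=> i i' /eqP; rewrite /p !(tnth_nth 0%N) nth_uniq // => /eqP.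
  exact: val_inj.
- move=> i j; have := kk_in (p i) j.
  by rewrite mem_filter mem_iota => /andP[].
- by move=> i j; have [] := kkP (p i) j.
- move=> i c; apply: pbasis_free => //.
  + exact: kk_inj.
  + by move=> j; have [] := kkP (p i) j.
  + by move=> j; have [_] := kkP (p i) j.
move=> g.
have g_part q : q \in primes M -> g *+ crt_unit M q *+ q ^ logn q M = 0.
  move=> qM; have /dvdnP[d ->] := dvdn_crt_unit q M_gt0.
  by rewrite -mulrnA -p_part -mulnA [(M`_q^' * _)%N]mulnC partnC // mulnC mulrnA GM mul0rn.
have primeM q : q \in primes M -> prime q by rewrite mem_primes => /and3P[].
have spanM q : q \in primes M ->
    exists c, g *+ crt_unit M q = \sum_j H (q, kk q j) *+ c j.
  by move=> qM; apply: span (primeM _ qM) (g_part _ qM).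
have cP i := spanM _ (pP i).1.
exists (fun i => projT1 (cid (cP i))).
(* The Chinese remainder units sum to 1 and split g into primary components; the dropped primes
   contribute empty sums. *)
transitivity (\sum_(q <- primes M) g *+ crt_unit M q).
  have M0 : M%:R = 0 :> endo G by apply/endoP => x; rewrite endo_natr GM.
  rewrite big_tnth -{1}[g]endo1E -(sum_crt_unit M_gt0 M0).
  rewrite (big_morph (fun x : endo G => x g) (fun _ _ => erefl) (erefl _)).
  by apply: eq_bigr => i _; rewrite endo_natr.
rewrite (bigID (fun q => ks q != [::])) /= [X in _ + X]big1_seq ?addr0; last first.
  move=> q /andP[]; rewrite negbK => /eqP ks0 /spanM[c ->].
  by apply: big1 => j; have := kk_in q j; rewrite ks0.
rewrite -big_filter big_tnth; apply: eq_bigr => i _.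
exact: projT2 (cid (cP i)).
Qed.
End Decomposition.

(** * The characterisation *)

Lemma has_order_primary_sum (G : zmodType) (n : nat) (p : 'I_n -> nat)
    (t : 'I_n -> nat) (k : forall i : 'I_n, 'I_(t i) -> nat) :
  (forall i, prime (p i)) -> (forall i j, (0 < k i j)%N) ->
  zmod_isog G (primary_sum p k) -> has_order G (primary_order p k).
Proof.
move=> p_pr k_gt0 [f f_bij].
pose T : finType := {dffun forall i, {dffun forall j, 'Z_(p i ^ k i j)}}.
have cardT : #|T| = primary_order p k.
  rewrite card_dep_ffun foldrE big_image /=; apply: eq_bigr => i _.
  rewrite card_dep_ffun foldrE big_image /=; apply: eq_bigr => j _.
  by rewrite card_ord Zp_cast // primary_factor_gt1.
pose F (g : G) : nat := enum_rank (f g : T).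
have F_inj : injective F by apply: inj_comp (val_inj) (inj_comp enum_rank_inj (bij_inj f_bij)).
rewrite /has_order -cardT; have [f' _ f'K] := f_bij.
have <- : [set F x | x in [set: G]]%classic = `I_#|T|%classic.
  apply/seteqP; split=> [_ [g _ <-]|i /= lti] /=; first exact: ltn_ord.
  by exists (f' (enum_val (Ordinal lti) : T)) => //; rewrite /F f'K enum_valK.
by rewrite card_eq_sym; apply: inj_card_eq => x y _ _ /F_inj.
Qed.

Lemma cyclic_layer_isog (G H : zmodType) (p k : nat) :
  zmod_isog G H -> cyclic_layer H p k -> cyclic_layer G p k.
Proof.
move=> [f [f' fK f'K]] [w [wp [hw def_w] gen_w]].
have f_inj := can_inj fK.
exists (f' w); split.
- by apply: f_inj; rewrite raddfMn f'K wp raddf0.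
- by exists (f' hw); apply: f_inj; rewrite raddfMn !f'K.
move=> g h gp def_g.
have [||c [y def_fg]] := gen_w (f g) (f h).
- by rewrite -raddfMn gp raddf0.
- by rewrite -raddfMn -def_g.
by exists c, (f' y); apply: f_inj; rewrite raddfD !raddfMn !f'K.
Qed.

Lemma endo_natr_eq0 (G : zmodType) (N : nat) :
  (forall g : G, g *+ N = 0) -> N%:R = 0 :> endo G.
Proof. by move=> GN; apply/endoP => g; rewrite endo_natr GN. Qed.

Theorem corollary3p7 (m : nat) (hm : (0 < m)%N)
    (hm3 : m <> 1 %[mod 3]) (hm8 : m <> 1 %[mod 8]) (G : zmodType) :
  strongly_nil_clean (endo G) m <->
  exists (N n : nat) (p : n.-tuple nat) (t : 'I_n -> nat)
         (k : forall i : 'I_n, 'I_(t i) -> nat),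
    [/\ has_order G N /\ perm_eq p (primes N),
        (forall i j, (0 < k i j)%N) /\ (forall i, injective (k i)),
        zmod_isog G (primary_sum (tnth p) k)
      & forall i, (tnth p i - 1 %| m - 1)%N].
Proof.
split=> [clean|[N [n [p [t [k [[_ perm_p] [k_gt0 k_inj] isoG dvd_m]]]]]]]; last first.
  have p_pr i : prime (tnth p i).
    by have := mem_tnth i p; rewrite (perm_mem perm_p) mem_primes => /and3P[].
  have p_inj : injective (tnth p).
    by apply/tuple_uniqP; rewrite (perm_uniq perm_p) primes_uniq.
  have M_gt0 := primary_order_gt0 p_pr k_gt0.
  have GM (g : G) : g *+ primary_order (tnth p) k = 0.
    have [f f_bij] := isoG; apply: (bij_inj f_bij).
    by rewrite raddfMn primary_sum_bounded ?raddf0.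
  apply: (strongly_nil_clean_primes M_gt0) => //.
  - exact: endo_natr_eq0.
  - by move=> q /(primes_primary_order p_pr)[i <-].
  move=> x q; rewrite mem_primes => /and3P[q_pr _ _].
  apply: cyclic_layers_nilpotent => // K; apply: cyclic_layer_isog isoG _.
  exact: primary_sum_cyclic_layer.
have nil_m (x : endo G) : nilpotent_elt (x ^+ m - x).
  exact: nilpotent_potent (clean x).
have le_expm a : (a <= a ^ m)%N.
  by case: a => // a; rewrite -{1}(expn1 a.+1) leq_pexp2l.
(* Applied to multiplication by a, nilpotency bounds G; a = 2 gives a nonzero bound because m >
   1. *)
have nil_nat a : exists L, forall g : G, g *+ (a ^ m - a) ^ L = 0.
  have [L HL] := nil_m a%:R; exists L => g.
  rewrite -natrX -natrB -?natrX // in HL.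
  by rewrite -endo_natr HL.
have m_gt1 : (1 < m)%N by case: (m) hm hm3 => [|[|]].
have m3 : ~~ (3 %| m - 1)%N by apply/negP; rewrite -eqn_mod_dvd // => /eqP.
have m8 : ~~ (8 %| m - 1)%N by apply/negP; rewrite -eqn_mod_dvd // => /eqP.
have [L GM] := nil_nat 2%N.
have M_gt0 : (0 < (2 ^ m - 2) ^ L)%N.
  by rewrite expn_gt0 subn_gt0 -{1}(expn1 2) ltn_exp2l ?m_gt1.
have layers p k := all_layers_cyclic hm nil_m m3 m8 k (p := p).
have [n [p [t [k [p_uniq pP [k_gt0 k_inj] isoG]]]]] :=
  bounded_decomposition M_gt0 GM layers.
have p_pr i : prime (tnth p i) by have [] := pP i.
exists (primary_order (tnth p) k), n, p, t, k; split=> //.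
- split; first exact: has_order_primary_sum.
  apply: uniq_perm => //; first exact: primes_uniq.
  move=> q; apply/idP/idP => [/tnthP[i ->]|/(primes_primary_order p_pr)[i <-]].
    (* Each listed prime has at least one summand, hence divides the order. *)
    have [_ t_gt0 _] := pP i; rewrite mem_primes p_pr primary_order_gt0 //=.
    rewrite /primary_order (bigD1 i) //= (bigD1 (Ordinal t_gt0)) //= -mulnA.
    by apply/dvdn_mulr/dvdn_exp.
  exact: mem_tnth.
move=> i; have [_ _ [g gp g_n0]] := pP i.
(* If p did not divide a^m - a, the nonzero p-torsion element g would be killed by two coprime
   integers. *)
apply: pred_prime_dvdn => // a; have [L' HL] := nil_nat a.
apply/eqP; rewrite eqn_mod_dvd //; apply: contraT => ndvd.
case: g_n0; apply: (mulrn_coprime (b := (a ^ m - a) ^ L') _ gp (HL g)).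
by apply: coprimeXr; rewrite prime_coprime.
Qed.
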